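(* Let $\mathcal{I}=\{0,1,2,\dots\}$ and consider the system $(S_\lambda)$ with the special linear dependence on $\lambda$ described in the context, such that $\mathcal{B}_k^*\mathcal{C}_k=0$, $\mathcal{B}_k^*\mathcal{D}_k>0$, and $\mathcal{W}_k>0$ for all $k\in\mathcal{I}$. Suppose there exist a sequence $(h_k)_{k\in\mathcal{I}}$ of real numbers and a constant $h$ with $h_k\ge h>0$ for all $k\in\mathcal{I}$ such that $$\mathcal{A}_k^*\mathcal{C}_k\ge -h_k\mathcal{W}_{k+1}\quad(k\in\mathcal{I}),\qquad \sum_{k=0}^\infty\frac{1}{g_k\sqrt{h_k}}=\infty,$$ where $g_k:=\max\big\{1,\big\|\mathcal{W}_{k+1}^{-1/2}(\mathcal{B}_k^*\mathcal{D}_k)^{-1/2}\big\|_2\big\}$, and a constant $T\ge 0$ such that $$\Delta\Big(\frac1{h_k}\Big)g_k\le\frac{T}{\sqrt{h_k}},\qquad k\in\mathcal{I}.$$ Then the system $(S_\lambda)$ is in the limit point case for all $\lambda\in\mathbb{C}\setminus\mathbb{R}$, i.e., $q(\lambda)=n$ for all $\lambda\in\mathbb{C}\setminus\mathbb{R}$.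
   Context: Let $n\ge1$, $\mathcal{J}=\begin{pmatrix}0&I\\-I&0\end{pmatrix}\in\mathbb{C}^{2n\times2n}$. For $k\in\mathcal{I}=\{0,1,2,\dots\}$ and $\lambda\in\mathbb{C}$ the system $(S_\lambda)$ is $$z_k=(\mathcal{S}_k+\lambda\mathcal{V}_k)z_{k+1},\quad k\in\mathcal{I},\qquad \mathcal{S}_k=\begin{pmatrix}\mathcal{A}_k&\mathcal{B}_k\\ \mathcal{C}_k&\mathcal{D}_k\end{pmatrix},\quad \mathcal{V}_k=\begin{pmatrix}0&0\\ \mathcal{W}_k\mathcal{A}_k&\mathcal{W}_k\mathcal{B}_k\end{pmatrix},$$ where all blocks are complex $n\times n$ matrices, $\mathcal{S}_k^*\mathcal{J}\mathcal{S}_k=\mathcal{J}$, and $\mathcal{W}_k=\mathcal{W}_k^*\ge0$ for all $k\in\mathcal{I}$; the unknown is $z:\mathcal{I}\to\mathbb{C}^{2n}$. (The identity $\mathcal{S}_k^*\mathcal{J}\mathcal{S}_k=\mathcal{J}$ makes $\mathcal{A}_k^*\mathcal{C}_k$ and $\mathcal{B}_k^*\mathcal{D}_k$ Hermitian.) The weight matrix is $\Psi_k=\begin{pmatrix}\mathcal{W}_k&0\\0&0\end{pmatrix}$, and $z$ is square summable if $\sum_{k=0}^\infty z_k^*\Psi_kz_k<\infty$. $q(\lambda)$ denotes the dimension of the space of square summable solutions of $(S_\lambda)$; the system is in the limit point case for $\lambda$ if $q(\lambda)=n$. For Hermitian matrices, $>0$ means positive definite, and $X\ge Y$ means $X-Y$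 is positive semidefinite; $X^{1/2}$ is the positive definite square root; $\|\cdot\|_2$ is the spectral norm; $\Delta x_k=x_{k+1}-x_k$. *)

(* Defs.v *)
From mathcomp Require Import all_boot all_order all_algebra.
From mathcomp Require Import sesquilinear spectral.
From mathcomp Require Import all_classical all_reals all_analysis.
From mathcomp Require Import complex.

Set Implicit Arguments.
Unset Strict Implicit.
Unset Printing Implicit Defensive.

Import Order.TTheory GRing.Theory Num.Theory.

Local Open Scope classical_set_scope.
Local Open Scope ring_scope.
Local Open Scope sesquilinear_scope.
Local Open Scope complex_scope.

(** The complex field is [R[i]] for [R : realType]; there [0 <= c] (resp.
    [0 < c]) entails that [c] is real. *)

Section Matrices.
Context {R : realType}.
Local Notation C := R[i].

Definition psdmx n (X : 'M[C]_n) : Prop :=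
  X^t* = X /\ forall x : 'cV[C]_n, 0 <= (x^t* *m X *m x) 0 0.

Definition posdefmx n (X : 'M[C]_n) : Prop :=
  X^t* = X /\ forall x : 'cV[C]_n, x != 0 -> 0 < (x^t* *m X *m x) 0 0.

Definition gemx n (X Y : 'M[C]_n) : Prop := psdmx (X - Y).

(** The positive definite square root (unique when [X] is positive definite);
    the default value [0] is only used when no such root exists. *)
Definition sqrtmx n (X : 'M[C]_n) : 'M[C]_n :=
  xget 0 [set Y | posdefmx Y /\ Y *m Y = X].

Definition norm2 n (x : 'cV[C]_n) : R :=
  Num.sqrt (\sum_(i < n) Normc.normc (x i 0) ^+ 2).

(** The operator norm induced by [norm2]; for [0 < n] the set is nonempty
    and bounded. *)
Definition spectral_norm n (X : 'M[C]_n) : R :=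
  sup [set norm2 (X *m x) | x in [set x : 'cV[C]_n | norm2 x = 1]].

End Matrices.

(** [E] is a linear subspace of dimension [d]: it is the set of linear
    combinations of [d] linearly independent vectors. *)
Definition has_dim (F : fieldType) (V : lmodType F) (E : set V) (d : nat) :
    Prop :=
  exists b : 'I_d -> V,
    (forall c : 'I_d -> F, \sum_(i < d) c i *: b i = 0 -> forall i, c i = 0) /\
    E = [set v | exists c : 'I_d -> F, v = \sum_(i < d) c i *: b i].

Section System.
Context {R : realType} {n : nat}.
Local Notation C := R[i].

Definition Jmx : 'M[C]_(n + n) := block_mx 0 1%:M (- 1%:M) 0.

Variables Ak Bk Ck Dk Wk : nat -> 'M[C]_n.

Definition Smx (k : nat) : 'M[C]_(n + n) :=
  block_mx (Ak k) (Bk k) (Ck k) (Dk k).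

Definition Vmx (k : nat) : 'M[C]_(n + n) :=
  block_mx 0 0 (Wk k *m Ak k) (Wk k *m Bk k).

Definition Psimx (k : nat) : 'M[C]_(n + n) := block_mx (Wk k) 0 0 0.

Definition is_solution (lam : C) (z : nat -> 'cV[C]_(n + n)) : Prop :=
  forall k, z k = (Smx k + lam *: Vmx k) *m z k.+1.

(** [z_k^* Psi_k z_k] is a nonnegative real as soon as [Wk k] is positive
    semidefinite, so taking its real part loses nothing and the sum in
    [\bar R] is that of a nonnegative series. *)
Definition square_summable (z : nat -> 'cV[C]_(n + n)) : Prop :=
  (\sum_(0 <= k <oo) (complex.Re (((z k)^t* *m Psimx k *m z k) 0 0))%:E
     < +oo)%E.

Definition limit_point_case (lam : C) : Prop :=
  has_dim [set z | is_solution lam z /\ square_summable z] n.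

Definition gseq (k : nat) : R :=
  Num.max 1 (spectral_norm (invmx (sqrtmx (Wk k.+1)) *m
                            invmx (sqrtmx ((Bk k)^t* *m Dk k)))).

End System.

(* Main.v *)
Require Import Defs.
From mathcomp Require Import all_boot all_order all_algebra.
From mathcomp Require Import sesquilinear spectral.
From mathcomp Require Import all_classical all_reals all_analysis.
From mathcomp Require Import complex ring lra.

(** The hypothesis [B_k^* D_k > 0] makes [B_k] invertible, so [B_k^* C_k = 0]
    forces [C_k = 0], and then the symplectic identity gives [A_k^* D_k = I].
    For a solution [z = (x, u)] this yields
      [x_k^* u_k - x_(k+1)^* u_(k+1)
         = u_(k+1)^* B_k^* D_k u_(k+1) + lambda x_k^* W_k x_k].

    If [z] is square summable, put [v_k := u_(k+1)^* B_k^* D_k u_(k+1)] and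
    [F_k := 1 + sum_(j < k) v_j].  Then
      [|x_(k+1)^* u_(k+1)| / (g_k F_(k+1))
         <= x_(k+1)^* W_(k+1) x_(k+1) + v_k / F_(k+1)^2],
    which is summable because [v_k / F_(k+1)^2 <= 1 / F_k - 1 / F_(k+1)].
    Divergence of [sum 1 / (g_k sqrt h_k)] and [h_k >= h] therefore make
    [|x_(k+1)^* u_(k+1)| / F_(k+1)] small along a subsequence; since the real
    part of the identity bounds [F_k] by [|x_k^* u_k|] up to a constant, [F] is
    bounded and [liminf |x_k^* u_k| = 0].

    Hence, with [s] the sign of [Im lambda], the form [s Im (x_0^* u_0)], whose
    signature is [(n, n)], is positive on the initial values of square summable
    solutions, so there are at most [n] independent ones.  Conversely, [n] of
    them are limits of the solutions of the boundary problems [u_N = i s x_N],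
    taken along an ultrafilter on [N]. *)

Set Implicit Arguments.
Unset Strict Implicit.
Unset Printing Implicit Defensive.

Import Order.TTheory GRing.Theory Num.Theory.
Import numFieldNormedType.Exports.

Local Open Scope classical_set_scope.
Local Open Scope ring_scope.
Local Open Scope sesquilinear_scope.
Local Open Scope complex_scope.

Local Notation Re := complex.Re.
Local Notation Im := complex.Im.

(** * The Hermitian form on column vectors and Young inequalities *)

Section Dot.
Context {R : realType}.
Local Notation C := R[i].

Lemma trmxCD m n (a b : 'M[C]_(m, n)) : (a + b)^t* = a^t* + b^t*.
Proof. by rewrite linearD map_mxD. Qed.

Lemma trmxCZ m n c (a : 'M[C]_(m, n)) : (c *: a)^t* = c^* *: a^t*.
Proof. by rewrite linearZ map_mxZ. Qed.

Lemma trmxC_mul m n p (a : 'M[C]_(m, n)) (b : 'M[C]_(n, p)) :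
  (a *m b)^t* = b^t* *m a^t*.
Proof. by rewrite trmx_mul map_mxM. Qed.

Lemma trmxC_block m1 m2 n1 n2 (a : 'M[C]_(m1, n1)) (b : 'M[C]_(m1, n2))
  (c : 'M[C]_(m2, n1)) (d : 'M[C]_(m2, n2)) :
  (block_mx a b c d)^t* = block_mx (a^t*) (c^t*) (b^t*) (d^t*).
Proof. by rewrite tr_block_mx map_block_mx. Qed.

Definition dot n (a b : 'cV[C]_n) : C := (a^t* *m b) 0 0.

Lemma dotE n (a b : 'cV[C]_n) : dot a b = \sum_i (a i 0)^* * b i 0.
Proof. by rewrite /dot mxE; apply: eq_bigr => i _; rewrite !mxE. Qed.

Lemma dotDl n (a b c : 'cV[C]_n) : dot (a + b) c = dot a c + dot b c.
Proof. by rewrite /dot trmxCD mulmxDl mxE. Qed.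

Lemma dotDr n (a b c : 'cV[C]_n) : dot c (a + b) = dot c a + dot c b.
Proof. by rewrite /dot mulmxDr mxE. Qed.

Lemma dotZl n x (a b : 'cV[C]_n) : dot (x *: a) b = x^* * dot a b.
Proof. by rewrite /dot trmxCZ -scalemxAl mxE. Qed.

Lemma dotZr n x (a b : 'cV[C]_n) : dot a (x *: b) = x * dot a b.
Proof. by rewrite /dot -scalemxAr mxE. Qed.

Lemma dot0r n (a : 'cV[C]_n) : dot a 0 = 0.
Proof. by rewrite /dot mulmx0 mxE. Qed.

Lemma dotC n (a b : 'cV[C]_n) : dot b a = (dot a b)^*.
Proof.
rewrite !dotE rmorph_sum; apply: eq_bigr => i _.
by rewrite rmorphM /= mulrC; congr (_ * _); exact/esym/conjcK.
Qed.

Lemma dot_mull m n (M : 'M[C]_(m, n)) a b : dot (M *m a) b = dot a (M^t* *m b).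
Proof. by rewrite /dot trmxC_mul mulmxA. Qed.

Lemma Re_conj (x : C) : Re (x^*) = Re x. Proof. by case: x. Qed.
Lemma Im_conj (x : C) : Im (x^*) = - Im x. Proof. by case: x. Qed.

Lemma ReD (x y : C) : Re (x + y) = Re x + Re y.
Proof. by case: x y => [? ?] []. Qed.
Lemma ImD (x y : C) : Im (x + y) = Im x + Im y.
Proof. by case: x y => [? ?] []. Qed.
Lemma ReM (x y : C) : Re (x * y) = Re x * Re y - Im x * Im y.
Proof. by case: x y => [? ?] []. Qed.
Lemma ImM (x y : C) : Im (x * y) = Re x * Im y + Im x * Re y.
Proof. by case: x y => [? ?] []. Qed.

Lemma ge0_Re (x : C) : 0 <= x -> 0 <= Re x.
Proof. by case: x => a b; rewrite lecE /= => /andP[]. Qed.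

Lemma Re_dotxx n (a : 'cV[C]_n) :
  Re (dot a a) = \sum_i (Re (a i 0) ^+ 2 + Im (a i 0) ^+ 2).
Proof.
rewrite dotE (big_morph _ ReD (erefl _)); apply: eq_bigr => i _.
by rewrite ReM Re_conj Im_conj mulNr opprK -!expr2.
Qed.

Lemma Re_dotxx_ge0 n (a : 'cV[C]_n) : 0 <= Re (dot a a).
Proof. by rewrite Re_dotxx sumr_ge0 // => i _; rewrite addr_ge0 // sqr_ge0. Qed.

Lemma Im_dotxx n (a : 'cV[C]_n) : Im (dot a a) = 0.
Proof. by have := Im_conj (dot a a); rewrite -dotC; lra. Qed.

Lemma Re_dotxx_coord n (a : 'cV[C]_n) i :
  Re (a i 0) ^+ 2 + Im (a i 0) ^+ 2 <= Re (dot a a).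
Proof.
rewrite Re_dotxx (bigD1 i) //= lerDl sumr_ge0 // => j _.
by rewrite addr_ge0 // sqr_ge0.
Qed.

Lemma Re_dotxx_eq0 n (a : 'cV[C]_n) : Re (dot a a) <= 0 -> a = 0.
Proof.
move=> a0; apply/matrixP => i j; rewrite ord1 mxE.
have := le_trans (Re_dotxx_coord a i) a0.
move: (a i 0) => [x y] /= xy0; apply/eqP; rewrite eq_complex /=.
rewrite -(sqrf_eq0 x) -(sqrf_eq0 y) !eq_le !sqr_ge0 !andbT.
by have := sqr_ge0 x; have := sqr_ge0 y; lra.
Qed.

Lemma norm2E n (a : 'cV[C]_n) : norm2 a = Num.sqrt (Re (dot a a)).
Proof.
rewrite /norm2 Re_dotxx; congr Num.sqrt; apply: eq_bigr => i _.
by case: (a i 0) => x y /=; rewrite sqr_sqrtr // addr_ge0 // sqr_ge0.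
Qed.

Lemma norm2_sqr n (a : 'cV[C]_n) : norm2 a ^+ 2 = Re (dot a a).
Proof. by rewrite norm2E sqr_sqrtr // Re_dotxx_ge0. Qed.

(** Expand the squared norms of [r a + b] and [r a - b], which are nonnegative, and divide by
    [r]. *)
Lemma young_Re n (a b : 'cV[C]_n) (r : R) : 0 < r ->
  2 * `|Re (dot a b)| <= r * Re (dot a a) + r^-1 * Re (dot b b).
Proof.
move=> r0.
have H (e : R) : 0 <= r ^+ 2 * Re (dot a a) + 2 * (r * e) * Re (dot a b)
    + e ^+ 2 * Re (dot b b).
  have := Re_dotxx_ge0 (r%:C *: a + e%:C *: b).
  rewrite !(dotDl, dotDr, dotZl, dotZr) (dotC a b) !(ReD, ReM, ImM) /=.
  by rewrite !Re_conj !Im_conj /=; congr (_ <= _); ring.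
have rH (x : R) : 0 <= r ^+ 2 * Re (dot a a) - r * (2 * x) + Re (dot b b) ->
    2 * x <= r * Re (dot a a) + r^-1 * Re (dot b b).
  move=> h; rewrite -(ler_pM2l r0) mulrDr !mulrA divff ?gt_eqF// mul1r -expr2.
  lra.
case: (ger0P (Re (dot a b))) => _; apply: rH.
  by have := H (-1); congr (_ <= _); ring.
by have := H 1; congr (_ <= _); ring.
Qed.

(** Replacing [a] by ['i *: a] turns the real part of the product into its imaginary part without
    changing the norm. The average of the two real inequalities bounds both parts at once. *)
Lemma young_ReIm n (a b : 'cV[C]_n) (r : R) : 0 < r ->
  `|Re (dot a b)| + `|Im (dot a b)| <= r * Re (dot a a) + r^-1 * Re (dot b b).
Proof.
move=> r0; have := young_Re a b r0; have := young_Re ('i *: a) b r0.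
rewrite !(dotZl, dotZr) !(ReM, ImM) /= ?Re_conj ?Im_conj /= Im_dotxx.
rewrite !(mul0r, mulr0, mul1r, mulN1r, sub0r, subr0, add0r, opprK, oppr0).
lra.
Qed.
End Dot.

(** * Positive definite matrices, their square roots and the spectral norm *)

Section Pos.
Context {R : realType}.
Local Notation C := R[i].

Lemma posdefmx_dot n (X : 'M[C]_n) (x : 'cV[C]_n) :
  posdefmx X -> x != 0 -> 0 < dot x (X *m x).
Proof. by move=> [_ Xpos] /Xpos; rewrite /dot mulmxA. Qed.

Lemma posdefmx_dot_ge0 n (X : 'M[C]_n) (x : 'cV[C]_n) :
  posdefmx X -> 0 <= dot x (X *m x).
Proof.
move=> Xpos; have [->|x0] := eqVneq x 0; first by rewrite mulmx0 dot0r.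
exact/ltW/posdefmx_dot.
Qed.

Lemma ker_unitmx (F : fieldType) n (X : 'M[F]_n) :
  (forall x : 'cV[F]_n, X *m x = 0 -> x = 0) -> X \in unitmx.
Proof.
move=> kerX; rewrite -unitmx_tr -row_free_unit -kermx_eq0.
apply/eqP/row_matrixP => i.
rewrite row0 -[LHS]trmxK (kerX (row i (kermx X^T))^T) ?trmx0 //.
by rewrite -[X in X *m _]trmxK -trmx_mul -row_mul mulmx_ker row0 trmx0.
Qed.

Lemma posdefmx_unit n (X : 'M[C]_n) : posdefmx X -> X \in unitmx.
Proof.
move=> Xpos; apply: ker_unitmx => x Xx0; apply/eqP; apply: contraT => x0.
by have := posdefmx_dot Xpos x0; rewrite Xx0 dot0r ltxx.
Qed.

Lemma dot_delta n i (x : 'cV[C]_n) : dot (delta_mx i 0) x = x i 0.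
Proof. by rewrite /dot trmx_delta map_delta_mx -rowE mxE. Qed.

(** By the spectral theorem $X = P^* \mathrm{diag}(d) P$ with $P$ unitary and $d > 0$; take the
    square roots of the eigenvalues. *)
Lemma posdefmx_sqrt_exists n (X : 'M[C]_n) : posdefmx X ->
  exists Y, posdefmx Y /\ Y *m Y = X.
Proof.
move=> Xpos; have [Xh _] := Xpos.
have Xn : X \is normalmx by apply/normalmxP; rewrite Xh.
have [/unitarymxP PP Punit] := (spectral_unitarymx X, spectral_unit X).
have PV := invmx_unitary (spectral_unitarymx X).
move/orthomx_spectralP: Xn; rewrite PV.
set P := spectralmx X in PP PV Punit *; set d := spectral_diag X => XE.
have P'P : P^t* *m P = 1%:M by rewrite -PV mulVmx.
(* Each eigenvalue is the value of the quadratic form of [X] at the unit eigenvector $P^* e_i$. *)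
have d0 i : 0 < d 0 i.
  have -> : d 0 i = dot (P^t* *m delta_mx i 0) (X *m (P^t* *m delta_mx i 0)).
    rewrite dot_mull trmxCK XE !mulmxA PP mul1mx.
    rewrite -(mulmxA (diag_mx d)) PP mulmx1.
    by rewrite dot_delta mul_diag_mx !mxE !eqxx mulr1.
  apply: posdefmx_dot => //.
  apply: contra_eq_neq (erefl (delta_mx i 0 : 'cV[C]_n)) => Pd.
  have := congr1 (mulmx P) Pd; rewrite mulmxA PP mul1mx mulmx0.
  by move/matrixP/(_ i 0)/eqP; rewrite !mxE !eqxx oner_eq0.
pose s : 'rV[C]_n := \row_i sqrtC (d 0 i).
have s0 i : 0 < s 0 i by rewrite mxE sqrtC_gt0.
exists (P^t* *m diag_mx s *m P); split; last first.
  rewrite XE !mulmxA -(mulmxA (_ *m diag_mx s) P) PP mulmx1.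
  rewrite -[X in X *m P]mulmxA.
  rewrite mulmx_diag; congr (_ *m diag_mx _ *m _); apply/rowP => i.
  by rewrite !mxE -expr2 sqrtCK.
split.
  rewrite !trmxC_mul trmxCK mulmxA; congr (_ *m _ *m _).
  rewrite tr_diag_mx map_diag_mx; congr diag_mx; apply/rowP => i.
  by rewrite [LHS]mxE; apply: geC0_conj; rewrite ltW.
move=> x x0; set y := P *m x.
have y0 : y != 0.
  apply: contra_neq x0 => y0; rewrite -[x]mul1mx -P'P -mulmxA -/y y0.
  by rewrite mulmx0.
have -> : (x^t* *m (P^t* *m diag_mx s *m P) *m x) 0 0 = dot y (diag_mx s *m y).
  by rewrite /dot /y trmxC_mul !mulmxA.
have term i : (y i 0)^* * (diag_mx s *m y) i 0 = s 0 i * (y i 0 * (y i 0)^*).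
  by rewrite mul_diag_mx mxE; ring.
have term_ge0 i : 0 <= (y i 0)^* * (diag_mx s *m y) i 0.
  by rewrite term mulr_ge0 ?mulcJ_ge0 // ltW.
have [i yi] : exists i, y i 0 != 0.
  apply/existsP; apply: contraT => /existsPn yall.
  exfalso; apply: (elimN eqP y0); apply/colP => i.
  by have := yall i; rewrite negbK => /eqP ->; rewrite mxE.
rewrite dotE (bigD1 i) //= ltr_pwDl ?sumr_ge0// term mulr_gt0 //.
by rewrite lt0r mulcJ_ge0 mulf_neq0 // conjc_eq0.
Qed.

Lemma sqrtmxP n (X : 'M[C]_n) : posdefmx X ->
  posdefmx (sqrtmx X) /\ sqrtmx X *m sqrtmx X = X.
Proof.
move=> /posdefmx_sqrt_exists[Y HY].
exact: (@xgetPex _ 0 [set Y | posdefmx Y /\ Y *m Y = X] (ex_intro _ Y HY)).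
Qed.

Lemma norm2_ge0 n (x : 'cV[C]_n) : 0 <= norm2 x.
Proof. by rewrite norm2E sqrtr_ge0. Qed.

Lemma norm2Z n (r : R) (x : 'cV[C]_n) : norm2 (r%:C *: x) = `|r| * norm2 x.
Proof.
rewrite !norm2E dotZl dotZr !(ReM, ImM) /= Im_dotxx.
rewrite -sqrtr_sqr -sqrtrM ?sqr_ge0 //; congr Num.sqrt; ring.
Qed.

Lemma normc_ge0 (x : C) : 0 <= Normc.normc x.
Proof. by case: x => a b; rewrite sqrtr_ge0. Qed.

Lemma normc_coord_le n (x : 'cV[C]_n) i : Normc.normc (x i 0) <= norm2 x.
Proof.
rewrite norm2E; case E : (x i 0) => [a b] /=; rewrite ler_wsqrtr //.
by have := Re_dotxx_coord x i; rewrite E.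
Qed.

(** This makes the [sup] in [spectral_norm] a genuine upper bound. On the unit sphere every
    coordinate of [X *m x] is at most the sum [B] of the moduli of all entries of [X]. *)
Lemma spectral_norm_has_ub n (X : 'M[C]_n) :
  has_ubound [set norm2 (X *m x) | x in [set x : 'cV[C]_n | norm2 x = 1]].
Proof.
pose B := \sum_i \sum_j Normc.normc (X i j).
exists (Num.sqrt (\sum_(i < n) B ^+ 2)) => _ [x x1 <-].
rewrite /norm2 ler_wsqrtr //; apply: ler_sum => i _.
rewrite ler_sqr ?nnegrE ?normc_ge0 //; last first.
  by apply: sumr_ge0 => k _; apply: sumr_ge0 => j _; exact: normc_ge0.
rewrite mxE; apply: (@le_trans _ _ (\sum_j Normc.normc (X i j))); last first.
  rewrite [leRHS](bigD1 i) //= lerDl; apply: sumr_ge0 => k _.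
  by apply: sumr_ge0 => j _; exact: normc_ge0.
apply: (big_ind2 (fun a b => Normc.normc a <= b)) => [|a b c d ab cd|j _].
- by rewrite Normc.normc0.
- by apply: le_trans (le_normcD _ _) _; rewrite lerD.
- rewrite Normc.normcM ler_piMr ?normc_ge0 // -x1; exact: normc_coord_le.
Qed.

Lemma norm2_mulmx_le n (X : 'M[C]_n) (x : 'cV[C]_n) :
  norm2 (X *m x) <= spectral_norm X * norm2 x.
Proof.
have [x0|x0] := eqVneq (norm2 x) 0.
  have -> : x = 0 by apply: Re_dotxx_eq0; rewrite -norm2_sqr x0 expr0n.
  by rewrite mulmx0 -(scale0r 0) (norm2Z 0) normr0 mul0r mulr0.
have x_gt0 : 0 < norm2 x by rewrite lt0r x0 norm2_ge0.
rewrite -ler_pdivrMr // mulrC.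
have -> : (norm2 x)^-1 * norm2 (X *m x) = norm2 (X *m ((norm2 x)^-1%:C *: x)).
  by rewrite -scalemxAr norm2Z ger0_norm // invr_ge0 norm2_ge0.
apply: (ub_le_sup (spectral_norm_has_ub X)).
exists ((norm2 x)^-1%:C *: x) => //=.
by rewrite norm2Z ger0_norm ?invr_ge0 ?norm2_ge0 // mulVf.
Qed.

(** Apply Young to $W^{1/2}x$ and $W^{-1/2}u$, whose product is $x^*u$, and write $W^{-1/2}u =
    (W^{-1/2}G^{-1/2})\,G^{1/2}u$ to bring in the norm bounded by [g]. *)
Lemma young_weighted n (W G : 'M[C]_n) (g : R) (x u : 'cV[C]_n) (r : R) :
  posdefmx W -> posdefmx G -> 0 <= g ->
  spectral_norm (invmx (sqrtmx W) *m invmx (sqrtmx G)) <= g -> 0 < r ->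
  `|Re (dot x u)| + `|Im (dot x u)| <=
  r * Re (dot x (W *m x)) + r^-1 * (g ^+ 2 * Re (dot u (G *m u))).
Proof.
move=> Wpos Gpos g0 Ng r0.
have [SWpos SW] := sqrtmxP Wpos; have [SGpos SG] := sqrtmxP Gpos.
have [SWh _] := SWpos; have [SGh _] := SGpos.
have := young_ReIm (sqrtmx W *m x) (invmx (sqrtmx W) *m u) r0.
rewrite dot_mull SWh mulKVmx ?posdefmx_unit // dot_mull SWh mulmxA SW.
move=> /le_trans; apply; rewrite lerD2l ler_wpM2l ?invr_ge0 ?(ltW r0) //.
have -> : Re (dot u (G *m u)) = norm2 (sqrtmx G *m u) ^+ 2.
  by rewrite norm2_sqr dot_mull SGh mulmxA SG.
rewrite -norm2_sqr -exprMn ler_sqr ?nnegrE ?norm2_ge0 //; last first.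
  by rewrite mulr_ge0 ?norm2_ge0.
have -> : invmx (sqrtmx W) *m u =
    invmx (sqrtmx W) *m invmx (sqrtmx G) *m (sqrtmx G *m u).
  by rewrite -mulmxA mulKmx ?posdefmx_unit.
apply: le_trans (norm2_mulmx_le _ _) _.
by rewrite ler_wpM2r // norm2_ge0.
Qed.
End Pos.

(** * Nonnegative series and smallness along a subsequence *)

Section Series.
Context {R : realType}.
Implicit Types a b s : nat -> R.

Lemma sum_bounded_lty a M : (forall k, 0 <= a k) ->
  (forall N, \sum_(0 <= k < N) a k <= M) ->
  (\sum_(0 <= k <oo) (a k)%:E < +oo)%E.
Proof.
move=> a0 aM; apply: (@le_lt_trans _ _ M%:E); last exact: ltry.
apply: lime_le; first by apply: is_cvg_nneseries => k _ _; rewrite lee_fin.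
by apply: nearW => N; rewrite sumEFin lee_fin.
Qed.

Lemma lty_sum_bounded a : (forall k, 0 <= a k) ->
  (\sum_(0 <= k <oo) (a k)%:E < +oo)%E ->
  exists M, forall N, \sum_(0 <= k < N) a k <= M.
Proof.
move=> a0 aoo; set S := (X in (X < _)%E) in aoo.
have S0 : (0 <= S)%E by apply: nneseries_ge0 => k _ _; rewrite lee_fin.
exists (fine S) => N; rewrite -lee_fin fineK ?ge0_fin_numE// -sumEFin.
by apply: nneseries_lim_ge => k _ _; rewrite lee_fin.
Qed.

(** If [s] stayed above [e] from [K] on, then [a k <= b k / e] there, and the series of [a] would
    converge. *)
Lemma divergent_weight_inf a b s M : (forall k, 0 <= a k) ->
  (forall k, 0 <= b k) -> (\sum_(0 <= k <oo) (a k)%:E = +oo)%E ->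
  (forall k, a k * s k <= b k) ->
  (forall N, \sum_(0 <= k < N) b k <= M) ->
  forall (e : R) K, 0 < e -> exists2 k, (K <= k)%N & s k < e.
Proof.
move=> a0 b0 aoo asb bM e K e0; apply: contrapT => nk.
have es k : (K <= k)%N -> e <= s k.
  by move=> Kk; rewrite leNgt; apply/negP => sk; apply: nk; exists k.
suff : (\sum_(0 <= k <oo) (a k)%:E < +oo)%E by rewrite aoo ltxx.
apply: (@sum_bounded_lty a (\sum_(0 <= k < K) a k + e^-1 * M)) => // N.
have NK : \sum_(0 <= k < N) a k <=
    \sum_(0 <= k < N) ((if (k < K)%N then a k else 0) + e^-1 * b k).
  apply: ler_sum => k _; case: ltnP => kK.
    by rewrite lerDl mulr_ge0 // invr_ge0 ltW.
  rewrite add0r -(ler_pM2l e0) mulrA divff ?gt_eqF// mul1r mulrC.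
  by apply: le_trans (asb k); rewrite ler_wpM2l // es.
apply: le_trans NK _; rewrite big_split /= lerD //; last first.
  by rewrite -mulr_sumr ler_wpM2l // invr_ge0 ltW.
rewrite -big_mkcond /=; have [NK|KN] := leqP N K.
  rewrite [leRHS](big_cat_nat (n := N)) //= big_mkcond /= ler_wpDr ?sumr_ge0//.
  by apply: ler_sum => k _; case: ifP.
rewrite (big_cat_nat (n := K)) ?(ltnW KN)//= [X in _ + X]big_nat_cond.
rewrite [X in _ + X]big_pred0 ?addr0; last first.
  by move=> k; case: (leqP K k); rewrite ?andbF.
by rewrite [leLHS]big_mkcond; apply: ler_sum => k _; case: ifP.
Qed.

(** Scalar core of the argument: [w] stands for $x^*Wx$, [v] for the form of $B^*D$, [y] for
    $\mathrm{Re}\,(x^*u)$, [c] for $\mathrm{Re}\,\lambda$, and [t] dominates [y] one index later.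
    Dividing by the partial sums [F] makes the possibly divergent series of [v] harmless. *)
Lemma liminf_energy (w v t y g hk : nat -> R) (c h M : R) :
  0 < h -> (forall k, h <= hk k) -> (forall k, 1 <= g k) ->
  (\sum_(0 <= k <oo) ((g k * Num.sqrt (hk k))^-1)%:E = +oo)%E ->
  (forall k, 0 <= w k) -> (forall N, \sum_(0 <= k < N) w k <= M) ->
  (forall k, 0 <= v k) ->
  (forall k, y k - y k.+1 = v k + c * w k) ->
  (forall k, `|y k.+1| <= t k) ->
  (forall k r, 0 < r -> t k <= r * w k.+1 + r^-1 * (g k ^+ 2 * v k)) ->
  forall e : R, 0 < e -> exists k, t k < e.
Proof.
move=> h0 hhk g1 goo w0 wM v0 yE yt tE.
have g0 k : 0 < g k := lt_le_trans ltr01 (g1 k).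
pose F N := 1 + \sum_(0 <= k < N) v k.
have F1 N : 1 <= F N by rewrite lerDl sumr_ge0.
have F0 N : 0 < F N := lt_le_trans ltr01 (F1 N).
have FS N : F N.+1 = F N + v N by rewrite /F big_nat_recr //= addrA.
have Fmono : {homo F : m n / (m <= n)%N >-> m <= n}.
  by apply: homo_leq => // [? ? ?|k]; [exact: le_trans|rewrite FS lerDl].
pose s k := t k / F k.+1.
pose q k := (Num.sqrt h)^-1 * (w k.+1 + ((F k)^-1 - (F k.+1)^-1)).
have sh0 : 0 < Num.sqrt h by rewrite sqrtr_gt0.
(* The right side equals $v_k/(F_kF_{k+1})$, and $F_k \le F_{k+1}$. *)
have dF k : v k / F k.+1 ^+ 2 <= (F k)^-1 - (F k.+1)^-1.
  have -> : (F k)^-1 - (F k.+1)^-1 = v k / (F k * F k.+1).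
    by have := F0 k; have := F0 k.+1; rewrite FS => *; field; rewrite !gt_eqF.
  rewrite ler_wpM2l // lef_pV2 ?posrE ?exprn_gt0 ?mulr_gt0 // expr2.
  by rewrite ler_pM2r // FS lerDl.
have dF0 k : 0 <= (F k)^-1 - (F k.+1)^-1.
  by apply: le_trans (dF k); rewrite divr_ge0 // sqr_ge0.
have q0 k : 0 <= q k by rewrite mulr_ge0 ?invr_ge0 ?(ltW sh0)// addr_ge0.
have a0 k : 0 <= (g k * Num.sqrt (hk k))^-1.
  by rewrite invr_ge0 mulr_ge0 ?sqrtr_ge0 // ltW.
have t0 k : 0 <= t k := le_trans (normr_ge0 _) (yt k).
have asq k : (g k * Num.sqrt (hk k))^-1 * s k <= q k.
  have -> : (g k * Num.sqrt (hk k))^-1 * s k =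
      (Num.sqrt (hk k))^-1 * (s k / g k).
    by rewrite invfM; ring.
  have sk0 : 0 <= s k := divr_ge0 (t0 k) (ltW (F0 _)).
  apply: ler_pM; rewrite ?invr_ge0 ?sqrtr_ge0 ?(divr_ge0 sk0 (ltW (g0 k)))//.
    by rewrite lef_pV2 ?posrE ?sqrtr_gt0 ?(lt_le_trans h0 (hhk k))// ler_wsqrtr.
  (* With this value as the Young parameter, division by it leaves exactly $w_{k+1} +
     v_k/F_{k+1}^2$. *)
  have r0 : 0 < g k * F k.+1 by rewrite mulr_gt0.
  have : s k / g k <= w k.+1 + v k / F k.+1 ^+ 2.
    rewrite /s -mulrA -invfM ler_pdivrMr ?mulr_gt0 //.
    apply: le_trans (tE k _ r0) _.
    rewrite le_eqVlt; apply/orP; left; apply/eqP.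
    by have := g0 k; have := F0 k.+1 => *; field; rewrite !gt_eqF.
  by move/le_trans; apply; rewrite lerD2l.
have qM N : \sum_(0 <= k < N) q k <= (Num.sqrt h)^-1 * (M + 1).
  rewrite -mulr_sumr ler_wpM2l ?invr_ge0 ?(ltW sh0)// big_split /= lerD //.
    apply: le_trans (wM N.+1).
    by rewrite [leRHS]big_nat_recl //= lerDr.
  (* The differences telescope to $1/F_0 - 1/F_N$, at most 1 since $F_0 = 1$. *)
  rewrite -[leLHS]opprK -sumrN.
  under eq_bigr do rewrite opprB.
  rewrite telescope_sumr // opprB /F big_geq // addr0 invr1 gerBl.
  by rewrite invr_ge0 (ltW (F0 N)).
have sinf := divergent_weight_inf a0 q0 goo asq qM.
pose c0 := 1 + `|y 0%N| + `|c| * M.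
have yF N : y 0%N - y N = F N - 1 + c * \sum_(0 <= k < N) w k.
  elim: N => [|N IH]; first by rewrite /F !big_geq //; ring.
  rewrite FS big_nat_recr //=; have := yE N; move: IH; lra.
have M0 : 0 <= M by apply: le_trans (wM 0%N); rewrite big_geq.
have c00 : 0 < c0.
  have := mulr_ge0 (normr_ge0 c) M0; have := normr_ge0 (y 0%N).
  rewrite /c0; lra.
have Ft k : F k.+1 <= c0 + t k.
  have := yF k.+1; have : `|c * \sum_(0 <= j < k.+1) w j| <= `|c| * M.
    by rewrite normrM ler_wpM2l // ger0_norm // sumr_ge0.
  have := yt k; have := ler_norm (y 0%N); have := ler_norm (- y k.+1).
  rewrite normrN.
  have := ler_norm (- (c * \sum_(0 <= j < k.+1) w j)); rewrite normrN /c0.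
  lra.
(* At an index $k \ge K$ where [t k] is below half of [F k.+1], [Ft] absorbs that half; monotonicity
   brings the bound back to [K]. *)
have Fb K : F K <= 2 * c0.
  have [k Kk sk] := sinf (1/2) K ltac:(lra).
  apply: le_trans (Fmono _ _ (leqW Kk)) _.
  have := Ft k; move: sk; rewrite /s ltr_pdivrMr //; lra.
move=> e e0.
have [|k _ sk] := sinf (e / (2 * c0)) 0%N.
  by rewrite divr_gt0 // mulr_gt0.
exists k; move: sk; rewrite ltr_pdivrMr // => /lt_le_trans; apply.
rewrite -[leRHS]mulr1 -mulrA ler_pM2l // mulrC ler_pdivrMr ?mulr_gt0 // mul1r.
exact: Fb.
Qed.

End Series.

(** * Limits of bounded real, complex and matrix sequences along an ultrafilter *)

Section Ultra.
Context {R : realType}.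
Local Notation C := R[i].
Context (U : set_system nat) {UU : UltraFilter U}.

(** Compactness of $[-M, M]$ gives a cluster point, and a cluster point of an ultrafilter is a
    limit. One [U] serves all coordinates, so no subsequences are extracted. *)
Lemma bounded_cvg_ultra (f : nat -> R) (M : R) : (forall N, `|f N| <= M) ->
  exists l : R, f @ U --> l.
Proof.
move=> fM; have fU : U (f @^-1` `[- M, M]%classic).
  apply: (filterS _ (@filterT _ U _)) => N _.
  by rewrite /= in_itv /= -ler_norml.
have [l [_ clu]] := @segment_compact R (- M) M (fmap f U) _ fU.
exists l => A lA; have [//|nA] := in_ultra_setVsetC (f @^-1` A) UU.
have [|y [/= ny Ay]] := clu (~` A) A _ lA; last by case: (ny Ay).
exact: nA.
Qed.

(** Convergence is split into real and imaginary parts, so that only the topology of [R] is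
    involved. *)
Definition cvgC (f : nat -> C) (l : C) :=
  (fun N => Re (f N)) @ U --> Re l /\ (fun N => Im (f N)) @ U --> Im l.

Lemma cvgC_cst c : cvgC (fun=> c) c.
Proof. by split; exact: cvg_cst. Qed.

Lemma cvgC_conj f l : cvgC f l -> cvgC (fun N => (f N)^*) l^*.
Proof.
move=> [fr fi]; split; rewrite ?Re_conj ?Im_conj.
  by under eq_fun do rewrite Re_conj.
by under eq_fun do rewrite Im_conj; exact: cvgN.
Qed.

Lemma cvgCD f g l m : cvgC f l -> cvgC g m -> cvgC (fun N => f N + g N) (l + m).
Proof.
move=> [fr fi] [gr gi]; split; rewrite ?ReD ?ImD.
  by under eq_fun do rewrite ReD; exact: cvgD.
by under eq_fun do rewrite ImD; exact: cvgD.
Qed.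

Lemma cvgCM f g l m : cvgC f l -> cvgC g m -> cvgC (fun N => f N * g N) (l * m).
Proof.
move=> [fr fi] [gr gi]; split; rewrite ?ReM ?ImM.
  by under eq_fun do rewrite ReM; apply: cvgB; exact: cvgM.
by under eq_fun do rewrite ImM; apply: cvgD; exact: cvgM.
Qed.


Definition cvg_mx m n (f : nat -> 'M[C]_(m, n)) (l : 'M[C]_(m, n)) :=
  forall i j, cvgC (fun N => f N i j) (l i j).

Lemma cvg_mx_cst m n (c : 'M[C]_(m, n)) : cvg_mx (fun=> c) c.
Proof. by move=> i j; exact: cvgC_cst. Qed.

Lemma cvg_mxM m n p (f : nat -> 'M[C]_(m, n)) (g : nat -> 'M[C]_(n, p)) k l :
  cvg_mx f k -> cvg_mx g l -> cvg_mx (fun N => f N *m g N) (k *m l).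
Proof.
move=> fk gl i j; rewrite mxE.
have -> : (fun N => (f N *m g N) i j) = fun N => \sum_x f N i x * g N x j.
  by apply/funext => N; rewrite mxE.
elim: (index_enum _) => [|x s IH].
  by rewrite big_nil; under eq_fun do rewrite big_nil; exact: cvgC_cst.
rewrite big_cons; under eq_fun do rewrite big_cons.
by apply: cvgCD IH; exact: cvgCM.
Qed.

Lemma cvg_mx_trmxC m n (f : nat -> 'M[C]_(m, n)) l :
  cvg_mx f l -> cvg_mx (fun N => (f N)^t*) (l^t*).
Proof.
move=> fl i j; rewrite !mxE; under eq_fun do rewrite !mxE.
exact: cvgC_conj.
Qed.

Lemma cvg_mx_usub m1 m2 n (f : nat -> 'M[C]_(m1 + m2, n)) l :
  cvg_mx f l -> cvg_mx (fun N => usubmx (f N)) (usubmx l).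
Proof. by move=> fl i j; rewrite mxE; under eq_fun do rewrite mxE. Qed.

Lemma cvg_mx_uniq m n (f : nat -> 'M[C]_(m, n)) l k :
  cvg_mx f l -> cvg_mx f k -> l = k.
Proof.
move=> fl fk; apply/matrixP => i j; apply/eqP; rewrite eq_complex.
have [[a b] [c d]] := (fl i j, fk i j).
by rewrite (cvg_unique _ a c) ?(cvg_unique _ b d) ?eqxx //; exact: Rhausdorff.
Qed.

Lemma bounded_cvg_mx m (f : nat -> 'cV[C]_m) (M : R) :
  (forall N, Re (dot (f N) (f N)) <= M) -> exists l, cvg_mx f l.
Proof.
move=> fM.
have H (i : 'I_m) : exists l : C, cvgC (fun N => f N i 0) l.
  have bnd N (x : R) : x ^+ 2 <= Re (f N i 0) ^+ 2 + Im (f N i 0) ^+ 2 ->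
      `|x| <= Num.sqrt M.
    move=> h; rewrite -sqrtr_sqr ler_wsqrtr // (le_trans h) //.
    exact: le_trans (Re_dotxx_coord (f N) i) (fM N).
  have [a fa] : exists a : R, (fun N => Re (f N i 0)) @ U --> a.
    apply: (@bounded_cvg_ultra _ (Num.sqrt M)) => N; apply: (bnd N).
    by rewrite lerDl sqr_ge0.
  have [b fb] : exists b : R, (fun N => Im (f N i 0)) @ U --> b.
    apply: (@bounded_cvg_ultra _ (Num.sqrt M)) => N; apply: (bnd N).
    by rewrite lerDr sqr_ge0.
  by exists (Complex a b).
have /choice[l fl] := H.
by exists (\col_i l i) => i j; rewrite mxE ord1.
Qed.

End Ultra.

(** * Block structure, energy identity and transfer matrices of the system *)

Section Sys.
Context {R : realType} {n : nat}.
Local Notation C := R[i].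
Context (Ak Bk Ck Dk Wk : nat -> 'M[C]_n).
Local Notation S := (Smx Ak Bk Ck Dk).
Local Notation V := (Vmx Ak Bk Wk).

(** Invertibility of $B^*D$ makes $B$ invertible, which kills $C$; the upper right block of the
    symplectic identity, $A^*D - C^*B = I$, then gives the second claim. *)
Lemma symplectic_blocks k : (S k)^t* *m Jmx *m S k = Jmx ->
  (Bk k)^t* *m Ck k = 0 -> posdefmx ((Bk k)^t* *m Dk k) ->
  Ck k = 0 /\ (Ak k)^t* *m Dk k = 1%:M.
Proof.
move=> SJS BC0 /posdefmx_unit; rewrite unitmx_mul => /andP[BU _].
have C0 : Ck k = 0 by rewrite -[LHS](mulKmx BU) BC0 mulmx0.
split=> //; move: SJS; rewrite /Smx /Jmx C0 trmxC_block !mulmx_block.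
move/eq_block_mx => [_ + _ _]; rewrite trmx0 map_mx0.
by rewrite !(mul0mx, mulmx0, mulmxN, mulmx1, oppr0, add0r, addr0, subr0).
Qed.

Context (C0 : forall k, Ck k = 0) (AD1 : forall k, (Ak k)^t* *m Dk k = 1%:M).
Context (lam : C).
Local Notation T k := (S k + lam *: V k).
Local Notation G k := ((Bk k)^t* *m Dk k).
Implicit Type z : nat -> 'cV[C]_(n + n).

(** The $\lambda$ term is expressed through the new upper half $x_k = A_kx_{k+1} + B_ku_{k+1}$, so
    that $u_k = D_ku_{k+1} + \lambda W_kx_k$. *)
Lemma solution_blocks k (z : 'cV[C]_(n + n)) :
  usubmx (T k *m z) = Ak k *m usubmx z + Bk k *m dsubmx z /\
  dsubmx (T k *m z) =
    Dk k *m dsubmx z + lam *: (Wk k *m usubmx (T k *m z)).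
Proof.
rewrite -[z in T k *m z]vsubmxK /Smx /Vmx scale_block_mx.
rewrite add_block_mx mul_block_col.
rewrite !col_mxKu !col_mxKd !scaler0 !addr0 C0 add0r; split=> //.
rewrite mulmxDl mulmxDr scalerDr -!scalemxAl !mulmxA.
by rewrite addrCA.
Qed.

Lemma transfer_unit k : T k \in unitmx.
Proof.
have /mulmx1_unit[AU DU] := AD1 k.
apply: ker_unitmx => z Tz0; have := solution_blocks k z.
rewrite Tz0 !(linear0 usubmx) !(linear0 dsubmx) mulmx0 scaler0 addr0.
move=> [Az Dz].
have d0 : dsubmx z = 0 by rewrite -(mulKmx DU (dsubmx z)) -Dz mulmx0.
move: Az AU; rewrite d0 mulmx0 addr0 map_unitmx unitmx_tr => Az AU.
have u0 : usubmx z = 0 by rewrite -(mulKmx AU (usubmx z)) -Az mulmx0.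
by rewrite -[z]vsubmxK d0 u0 col_mx0.
Qed.

(** Substitute for $u_k$, then for $x_k$ in the product with $D_ku_{k+1}$; $A_k^*D_k = I$ reduces
    the first term to $x_{k+1}^*u_{k+1}$. *)
Lemma energy_step z k : is_solution Ak Bk Ck Dk Wk lam z ->
  dot (usubmx (z k)) (dsubmx (z k)) =
  dot (usubmx (z k.+1)) (dsubmx (z k.+1)) +
  dot (dsubmx (z k.+1)) (G k *m dsubmx (z k.+1)) +
  lam * dot (usubmx (z k)) (Wk k *m usubmx (z k)).
Proof.
move=> sol; have := solution_blocks k (z k.+1); rewrite -(sol k) => -[xE uE].
rewrite {1}uE dotDr dotZr {1}xE dotDl !dot_mull mulmxA AD1 mul1mx.
by rewrite mulmxA.
Qed.

(** The recursion of the system runs backwards, so this product carries $z_k$ to $z_0$; solutions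
    are propagated forwards by its inverse. *)
Fixpoint Phi k : 'M[C]_(n + n) := if k is j.+1 then Phi j *m T j else 1%:M.

Lemma Phi_unit k : Phi k \in unitmx.
Proof.
by elim: k => [|k IH]; rewrite ?unitmx1 //= unitmx_mul IH transfer_unit.
Qed.

Definition solution_from (z0 : 'cV[C]_(n + n)) k := invmx (Phi k) *m z0.

Lemma solution_from_at (z0 : 'cV[C]_(n + n)) k :
  z0 = Phi k *m solution_from z0 k.
Proof. by rewrite mulKVmx ?Phi_unit. Qed.

Lemma solution_fromP (z0 : 'cV[C]_(n + n)) :
  is_solution Ak Bk Ck Dk Wk lam (solution_from z0).
Proof.
move=> k; apply: (canLR (mulKmx (Phi_unit k))).
by rewrite mulmxA; exact: (solution_from_at z0 k.+1).
Qed.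

Lemma solution_from0 (z0 : 'cV[C]_(n + n)) : solution_from z0 0%N = z0.
Proof. by rewrite /solution_from /= invmx1 mul1mx. Qed.

Lemma solution_uniq z :
  is_solution Ak Bk Ck Dk Wk lam z -> z = solution_from (z 0%N).
Proof.
move=> sol; apply/funext => k; rewrite /solution_from.
have -> : z 0%N = Phi k *m z k.
  by elim: k => [|k IH] /=; rewrite ?mul1mx // IH {1}sol mulmxA.
by rewrite mulKmx ?Phi_unit.
Qed.

Lemma solution_from_sum m (c : 'I_m -> C) (z0 : 'I_m -> 'cV[C]_(n + n)) :
  solution_from (\sum_i c i *: z0 i) = \sum_i c i *: solution_from (z0 i).
Proof.
apply/funext => k; rewrite /solution_from fct_sumE mulmx_sumr.
by apply: eq_bigr => i _; rewrite -scalemxAr.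
Qed.

End Sys.

(** * Weyl theory: the dimension of the space of square summable solutions *)

Section Weyl.
Context {R : realType} {n : nat}.
Local Notation C := R[i].
Context (Ak Bk Ck Dk Wk : nat -> 'M[C]_n).
Context (C0 : forall k, Ck k = 0) (AD1 : forall k, (Ak k)^t* *m Dk k = 1%:M).
Context (W_posdef : forall k, posdefmx (Wk k)).
Context (BD_posdef : forall k, posdefmx ((Bk k)^t* *m Dk k)).
Context (lam : C) (sg : R) (sg2 : sg * sg = 1) (sg_Im : 0 < sg * Im lam).
Local Notation is_sol := (is_solution Ak Bk Ck Dk Wk lam).
Local Notation sol := (solution_from Ak Bk Ck Dk Wk lam).
Local Notation Phi := (Phi Ak Bk Ck Dk Wk lam).
Implicit Types (z : nat -> 'cV[C]_(n + n)) (x : 'cV[C]_(n + n)).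

Definition weight z k : R := Re (dot (usubmx (z k)) (Wk k *m usubmx (z k))).

Lemma weight_ge0 z k : 0 <= weight z k.
Proof. exact/ge0_Re/posdefmx_dot_ge0. Qed.

Lemma square_summableE z :
  square_summable Wk z = (\sum_(0 <= k <oo) (weight z k)%:E < +oo)%E.
Proof.
rewrite /square_summable; congr (_ < _)%E; apply: eq_eseriesr => k _.
congr EFin.
rewrite /weight /dot -{1 2}[z k]vsubmxK tr_col_mx map_row_mx mul_row_block.
by rewrite !mulmx0 !addr0 mul_row_col mul0mx addr0 mulmxA.
Qed.

Let sol_solution x : is_sol (sol x).
Proof. exact: solution_fromP. Qed.

(** The Cayley transform [(x, u) |-> (u + i sg x, u - i sg x)] diagonalizes the
    form [sg * Im (x^* u)], of signature [(n, n)]. *)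
Definition ii_sg : C := Complex 0 sg.
Definition cayley_p x := dsubmx x + ii_sg *: usubmx x.
Definition cayley_m x := dsubmx x - ii_sg *: usubmx x.
Definition imform x : R := sg * Im (dot (usubmx x) (dsubmx x)).

Lemma cayley_diff x : Re (dot (cayley_p x) (cayley_p x)) -
  Re (dot (cayley_m x) (cayley_m x)) = 4 * imform x.
Proof.
rewrite /cayley_p /cayley_m /ii_sg /imform -scaleNr.
rewrite !(dotDl, dotDr, dotZl, dotZr).
rewrite (dotC (usubmx x) (dsubmx x)) !(ReD, ReM, ImM, Re_conj, Im_conj) /=.
ring.
Qed.

Lemma cayley_sum x : Re (dot (cayley_p x) (cayley_p x)) +
  Re (dot (cayley_m x) (cayley_m x)) = 2 * Re (dot x x).
Proof.
have -> : Re (dot x x) =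
    Re (dot (usubmx x) (usubmx x)) + Re (dot (dsubmx x) (dsubmx x)).
  by rewrite -{1 2}[x]vsubmxK /dot tr_col_mx map_row_mx mul_row_col mxE ReD.
rewrite /cayley_p /cayley_m /ii_sg -scaleNr !(dotDl, dotDr, dotZl, dotZr).
rewrite (dotC (usubmx x) (dsubmx x)) !(ReD, ReM, ImM, Re_conj, Im_conj) /=.
by ring: sg2.
Qed.

Lemma imform_le x : 4 * imform x <= Re (dot (cayley_p x) (cayley_p x)).
Proof. by rewrite -cayley_diff gerBl Re_dotxx_ge0. Qed.

(** Imaginary part of the energy identity: the forms of $W_k$ and $B_k^*D_k$ are real, so only
    $\mathrm{Im}\,\lambda$ times the weight survives. *)
Lemma imform_step z k : is_sol z ->
  imform (z k) = imform (z k.+1) + sg * Im lam * weight z k.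
Proof.
move=> zsol; rewrite /imform (energy_step C0 AD1 k zsol) /weight.
have Wr := ger0_Im (posdefmx_dot_ge0 (usubmx (z k)) (W_posdef k)).
have Gr := ger0_Im (posdefmx_dot_ge0 (dsubmx (z k.+1)) (BD_posdef k)).
rewrite !ImD Gr ImM Wr; ring.
Qed.

Lemma imform_sum z N : is_sol z ->
  imform (z 0%N) = imform (z N) + sg * Im lam * \sum_(0 <= k < N) weight z k.
Proof.
move=> zsol; elim: N => [|N IH]; first by rewrite big_geq // mulr0 addr0.
rewrite IH (imform_step _ zsol) big_nat_recr //= mulrDr -addrA.
by rewrite (addrC (_ * weight _ _)).
Qed.

Lemma cayley_pE x : cayley_p x = row_mx ii_sg%:M 1%:M *m x.
Proof.
by rewrite -{2}[x]vsubmxK mul_row_col mul1mx mul_scalar_mx addrC.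
Qed.

Lemma cayley_p_sum m (c : 'I_m -> C) (y : 'I_m -> 'cV[C]_(n + n)) :
  cayley_p (\sum_i c i *: y i) = \sum_i c i *: cayley_p (y i).
Proof.
rewrite cayley_pE mulmx_sumr; apply: eq_bigr => i _.
by rewrite -scalemxAr -cayley_pE.
Qed.

Lemma imform_end (y : 'cV[C]_n) :
  imform (col_mx y (ii_sg *: y)) = Re (dot y y).
Proof.
rewrite /imform col_mxKu col_mxKd dotZr ImM /= Im_dotxx mulr0 add0r mulrA sg2.
exact: mul1r.
Qed.

(** Solutions with $u_N = i s x_N$ have [imform] equal to $|x_N|^2 \ge 0$ at [N], hence nonnegative
    at 0. All bounds depend on [e] only, not on [N], which permits a limit. *)
Lemma boundary_solution N (e : 'cV[C]_n) : exists x,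
  [/\ cayley_p x = e, 0 <= imform x,
      forall M, (M <= N)%N ->
        4 * (sg * Im lam) * \sum_(0 <= k < M) weight (sol x) k <= Re (dot e e)
    & Re (dot x x) <= Re (dot e e)].
Proof.
(* [Z] maps $y = x_N$ to the initial value of the boundary solution, and [MM] maps it to the
   [cayley_p] part of that value. *)
pose Z := Phi N *m col_mx 1%:M ii_sg%:M.
pose MM := row_mx ii_sg%:M 1%:M *m Z.
have solN y : sol (Z *m y) N = col_mx y (ii_sg *: y).
  rewrite /solution_from /Z -!mulmxA mulKmx ?Phi_unit // mul_col_mx mul1mx.
  by rewrite mul_scalar_mx.
have Zsum M y : (M <= N)%N ->
    Re (dot y y) + sg * Im lam * \sum_(0 <= k < M) weight (sol (Z *m y)) k <=
    imform (Z *m y).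
  move=> MN; have := imform_sum N (sol_solution (Z *m y)).
  rewrite solution_from0 solN imform_end => ->.
  rewrite lerD2l ler_wpM2l ?(ltW sg_Im) //.
  rewrite [leRHS](big_cat_nat (n := M)) //= lerDl sumr_ge0 // => k _.
  exact: weight_ge0.
have MMU : MM \in unitmx.
  (* If the [cayley_p] part vanishes, then [imform] is at most 0 there, while [Zsum] bounds it below
     by $|y|^2$. *)
  apply: ker_unitmx => y; rewrite -mulmxA -cayley_pE => p0.
  apply: Re_dotxx_eq0; have := Zsum 0%N y isT; have := imform_le (Z *m y).
  rewrite p0 dot0r big_geq // mulr0 addr0 /=; lra.
pose x := Z *m (invmx MM *m e).
have xe : cayley_p x = e by rewrite cayley_pE mulmxA mulKVmx.
have x0 : 0 <= imform x.
  apply: le_trans (Zsum 0%N _ isT); rewrite big_geq // mulr0 addr0.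
  exact: Re_dotxx_ge0.
exists x; split=> // [M MN|].
  have := Zsum M (invmx MM *m e) MN; have := imform_le x; rewrite xe.
  have := Re_dotxx_ge0 (invmx MM *m e); rewrite -/x; lra.
have := cayley_diff x; have := cayley_sum x; rewrite xe; lra.
Qed.

(** The initial values of the boundary solutions are bounded, so they converge along an ultrafilter;
    each partial sum depends continuously on the initial value. *)
Lemma limit_solution (e : 'cV[C]_n) : exists x, cayley_p x = e /\
  forall M, \sum_(0 <= k < M) weight (sol x) k <=
    (4 * (sg * Im lam))^-1 * Re (dot e e).
Proof.
have [xs xsP] := choice (fun N => boundary_solution N e).
have [U [UU oU]] := ultraFilterLemma eventually_filter.
have [x xsx] : exists x, cvg_mx U xs x.
  by apply: (@bounded_cvg_mx _ _ _ _ _ (Re (dot e e))) => N; have [] := xsP N.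
exists x; split.
  apply: (@cvg_mx_uniq _ U _ _ _ (fun=> e)); last exact: cvg_mx_cst.
  have -> : (fun=> e) = fun N => row_mx ii_sg%:M 1%:M *m xs N.
    by apply/funext => N; rewrite -cayley_pE; have [] := xsP N.
  by rewrite cayley_pE; apply: cvg_mxM => //; exact: cvg_mx_cst.
move=> M; have c0 : 0 < 4 * (sg * Im lam) by rewrite mulr_gt0.
rewrite mulrC ler_pdivlMr // mulrC.
suff wcvg : (fun N => \sum_(0 <= k < M) weight (sol (xs N)) k) @ U -->
    \sum_(0 <= k < M) weight (sol x) k.
  apply: (cvgr_to_le (cvgM (cvg_cst (4 * (sg * Im lam))) wcvg)).
  (* The bound is available for $N \ge M$ only; this set lies in [U], which refines [eventually]. *)
  by apply: oU; exists M => // N /= MN; have [_ _ + _] := xsP N; apply.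
elim: M => [|M IH].
  by rewrite big_geq //; under eq_fun do rewrite big_geq //; exact: cvg_cst.
rewrite big_nat_recr //=; under eq_fun do rewrite big_nat_recr //=.
apply: cvgD => //.
have solx : cvg_mx U (fun N => usubmx (sol (xs N) M)) (usubmx (sol x M)).
  by apply: cvg_mx_usub; apply: cvg_mxM => //; exact: cvg_mx_cst.
have [+ _] : cvgC U
    (fun N => dot (usubmx (sol (xs N) M)) (Wk M *m usubmx (sol (xs N) M)))
    (dot (usubmx (sol x M)) (Wk M *m usubmx (sol x M))).
  apply: cvg_mxM; first exact: cvg_mx_trmxC.
  by apply: cvg_mxM => //; exact: cvg_mx_cst.
exact.
Qed.

Context (vanish : forall z (M : R), is_sol z ->
  (forall N, \sum_(0 <= k < N) weight z k <= M) -> forall e : R, 0 < e ->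
  exists k, `|Im (dot (usubmx (z k.+1)) (dsubmx (z k.+1)))| < e).

(** If the [cayley_p] part is 0, then [imform x] is $-|x|^2/2$, and along the solution it can only
    decrease. It thus stays away from 0 unless $x = 0$, against [vanish]. *)
Lemma cayley_p_inj x :
  (exists M, forall N, \sum_(0 <= k < N) weight (sol x) k <= M) ->
  cayley_p x = 0 -> x = 0.
Proof.
move=> [M xM] x0; apply: Re_dotxx_eq0; rewrite leNgt; apply/negP => xx.
have [k] := vanish (sol_solution x) xM (e := Re (dot x x) / 2) ltac:(lra).
have := imform_sum k.+1 (sol_solution x).
rewrite solution_from0; have := cayley_diff x; have := cayley_sum x.
rewrite x0 dot0r /=.
have : 0 <= sg * Im lam * \sum_(0 <= j < k.+1) weight (sol x) j.
  by rewrite mulr_ge0 ?(ltW sg_Im) // sumr_ge0 // => j _; exact: weight_ge0.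
have sg1 : `|sg| = 1.
  by apply/eqP; rewrite -sqrp_eq1 // -normrX expr2 sg2 normr1.
have := ler_norm (- imform (sol x k.+1)); rewrite normrN normrM sg1 mul1r.
lra.
Qed.

Lemma square_summable_sum m (c : 'I_m -> C)
    (z : 'I_m -> nat -> 'cV[C]_(n + n)) :
  (forall i, square_summable Wk (z i)) ->
  square_summable Wk (\sum_i c i *: z i).
Proof.
have sZ a y : square_summable Wk y -> square_summable Wk (a *: y).
  rewrite !square_summableE => /(lty_sum_bounded (weight_ge0 y))[M yM].
  apply: (sum_bounded_lty (weight_ge0 _)
    (M := (Re a ^+ 2 + Im a ^+ 2) * M)) => N.
  have -> : \sum_(0 <= k < N) weight (a *: y) k =
      (Re a ^+ 2 + Im a ^+ 2) * \sum_(0 <= k < N) weight y k.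
    rewrite mulr_sumr; apply: eq_bigr => k _.
    rewrite /weight linearZ /= -scalemxAr dotZl dotZr.
    rewrite !(ReM, ImM, Re_conj, Im_conj) /= ; ring.
  by rewrite ler_wpM2l ?addr_ge0 ?sqr_ge0.
have sD y y' : square_summable Wk y -> square_summable Wk y' ->
    square_summable Wk (y + y').
  rewrite !square_summableE => /(lty_sum_bounded (weight_ge0 y))[M yM].
  move=> /(lty_sum_bounded (weight_ge0 y'))[M' yM'].
  apply: (sum_bounded_lty (weight_ge0 _) (M := 2 * M + 2 * M')) => N.
  apply: (@le_trans _ _ (\sum_(0 <= k < N) (2 * weight y k + 2 * weight y' k))).
    (* Parallelogram law: the weights of [y + y'] and [y - y'] add up to twice those of [y] and
       [y']. *)
    apply: ler_sum => k _; have := weight_ge0 (y - y') k.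
    rewrite /weight (_ : usubmx ((y + y') k) = usubmx (y k) + usubmx (y' k));
      last exact: linearD.
    rewrite (_ : usubmx ((y - y') k) = usubmx (y k) + (-1) *: usubmx (y' k));
      last by rewrite scaleN1r; exact: linearB.
    rewrite !mulmxDr -!scalemxAr !(dotDl, dotDr, dotZl, dotZr).
    rewrite !(ReM, ImM, ReD, ImD, Re_conj, Im_conj) /=. lra.
  by rewrite big_split /= -!mulr_sumr lerD // ler_wpM2l.
move=> zs; elim: (index_enum _) => [|i s IH].
  rewrite big_nil square_summableE.
  apply: (sum_bounded_lty (weight_ge0 _) (M := 0)) => N; rewrite big1 // => k _.
  by rewrite /weight linear0 mulmx0 dot0r.
by rewrite big_cons; apply: sD => //; exact: sZ.
Qed.

(** The basis consists of the limit solutions whose [cayley_p] parts are the unit vectors. Applying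
    [cayley_p] shows independence, and its injectivity on square summable solutions shows that they
    span. *)
Lemma weyl_limit_point : limit_point_case Ak Bk Ck Dk Wk lam.
Proof.
have [xs xsP] := choice (fun i : 'I_n => limit_solution (delta_mx i 0)).
have summ i : square_summable Wk (sol (xs i)).
  rewrite square_summableE; have [_ xM] := xsP i.
  exact: sum_bounded_lty (weight_ge0 _) xM.
have cayE c : cayley_p (\sum_i c i *: xs i) = \col_i c i.
  rewrite cayley_p_sum; apply/colP => i; rewrite mxE summxE (bigD1 i) //=.
  rewrite big1 ?addr0 => [|j /negPf ji].
    by have [-> _] := xsP i; rewrite !mxE !eqxx mulr1.
  by have [-> _] := xsP j; rewrite !mxE [i == j]eq_sym ji mulr0.
exists (fun i => sol (xs i)); split=> [c|].
  rewrite -solution_from_sum => c0 i; have := cayE c.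
  have -> : \sum_i c i *: xs i = 0.
    by rewrite -[LHS](solution_from0 Ak Bk Ck Dk Wk lam) c0.
  rewrite cayley_pE mulmx0 => /colP/(_ i).
  by rewrite !mxE.
apply/seteqP; split=> [z [zsol zsum]|z [c ->]] /=; last first.
  split; last exact: square_summable_sum.
  by rewrite -solution_from_sum; exact: solution_fromP.
pose c i := cayley_p (z 0%N) i 0.
exists c; rewrite -solution_from_sum (solution_uniq C0 AD1 zsol); congr sol.
apply/eqP; rewrite -subr_eq0; apply/eqP.
have dE : z 0%N - \sum_i c i *: xs i = z 0%N + \sum_i (- c i) *: xs i.
  by rewrite -sumrN; congr (_ + _); apply: eq_bigr => i _; rewrite scaleNr.
apply: cayley_p_inj; last first.
  rewrite cayley_pE mulmxBr -!cayley_pE cayE.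
  have -> : \col_i c i = cayley_p (z 0%N) by apply/colP => i; rewrite mxE.
  exact: subrr.
apply: lty_sum_bounded => [k|]; first exact: weight_ge0.
rewrite -square_summableE.
(* The difference is rewritten as one combination of [n.+1] vectors, slot 0 holding [z 0] with
   coefficient 1, so that [square_summable_sum] applies. *)
pose x' (i : 'I_n.+1) := oapp xs (z 0%N) (unlift ord0 i).
pose c' (i : 'I_n.+1) := oapp (fun j => - c j) 1 (unlift ord0 i).
have -> : z 0%N - \sum_i c i *: xs i = \sum_i c' i *: x' i.
  rewrite dE big_ord_recl /c' /x' unlift_none /= scale1r; congr (_ + _).
  by apply: eq_bigr => i _; rewrite liftK.
rewrite solution_from_sum; apply: square_summable_sum => i; rewrite /x'.
by case: (unlift _ _) => [j|] /=; rewrite -?(solution_uniq C0 AD1 zsol).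
Qed.

End Weyl.

(** * The scalar energy estimate supplies the vanishing condition of the Weyl argument *)

Theorem theorem2p7 (R : realType) (n : nat) (n_ge1 : (1 <= n)%N)
  (Ak Bk Ck Dk Wk : nat -> 'M[R[i]]_n)
  (S_symplectic : forall k,
     (Smx Ak Bk Ck Dk k)^t* *m Jmx *m Smx Ak Bk Ck Dk k = Jmx)
  (W_psd : forall k, psdmx (Wk k))
  (BC_eq0 : forall k, (Bk k)^t* *m Ck k = 0)
  (BD_posdef : forall k, posdefmx ((Bk k)^t* *m Dk k))
  (W_posdef : forall k, posdefmx (Wk k))
  (hk : nat -> R) (h : R) (h_gt0 : 0 < h) (hk_ge : forall k, h <= hk k)
  (AC_ge : forall k, gemx ((Ak k)^t* *m Ck k) (- ((hk k)%:C *: Wk k.+1)))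
  (sum_infty :
     (\sum_(0 <= k <oo) ((gseq Bk Dk Wk k * Num.sqrt (hk k))^-1)%:E = +oo)%E)
  (T : R) (T_ge0 : 0 <= T)
  (delta_le : forall k,
     ((hk k.+1)^-1 - (hk k)^-1) * gseq Bk Dk Wk k <= T / Num.sqrt (hk k)) :
  forall lam : R[i], lam \isn't Num.real ->
    limit_point_case Ak Bk Ck Dk Wk lam.
Proof.
move=> lam lamNr.
have SB k := symplectic_blocks (S_symplectic k) (BC_eq0 k) (BD_posdef k).
have C0 k : Ck k = 0 by case: (SB k).
have AD1 k : (Ak k)^t* *m Dk k = 1%:M by case: (SB k).
have Im0 : Im lam != 0.
  by move: lamNr; case: lam => a b; rewrite complex_real.
have sg2 : Num.sg (Im lam) * Num.sg (Im lam) = 1 by rewrite -expr2 sqr_sg Im0.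
have sgI : 0 < Num.sg (Im lam) * Im lam by rewrite -normrEsg normr_gt0.
apply: (weyl_limit_point C0 AD1 W_posdef BD_posdef sg2 sgI) => z M zsol zM e e0.
pose x k := usubmx (z k); pose u k := dsubmx (z k).
pose v k := Re (dot (u k.+1) ((Bk k)^t* *m Dk k *m u k.+1)).
(* The real part enters the energy balance that bounds [F]; the imaginary part is what [vanish] asks
   for. The index [k.+1] matches $W_{k+1}$ and $B_k^*D_k$ in [gseq]. *)
pose t k := `|Re (dot (x k.+1) (u k.+1))| + `|Im (dot (x k.+1) (u k.+1))|.
pose y k := Re (dot (x k) (u k)).
have g1 k : 1 <= gseq Bk Dk Wk k by rewrite le_max lexx.
have [] := @liminf_energy R (weight Wk z) v t y (gseq Bk Dk Wk) hk (Re lam) h M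
  h_gt0 hk_ge g1 sum_infty (weight_ge0 W_posdef z) zM _ _ _ _ e e0.
- by move=> k; exact/ge0_Re/posdefmx_dot_ge0.
- move=> k; rewrite /y /x /u (energy_step C0 AD1 k zsol) !ReD ReM.
  rewrite (ger0_Im (posdefmx_dot_ge0 (usubmx (z k)) (W_posdef k))).
  rewrite /v /weight /u; ring.
- by move=> k; rewrite /t lerDl.
- move=> k r r0; apply: young_weighted => //.
    exact: le_trans ler01 (g1 k).
  by rewrite le_max lexx orbT.
move=> k tk; exists k; apply: le_lt_trans tk.
by rewrite lerDr.
Qed.
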